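(* Let $I$ be an ideal of a Novikov algebra $A$ over a field. If $x^n\in I$ for some $x\in A$ and some integer $n>0$, then $x^{s_k}\in I^{[k]}$ for every integer $k\ge 1$, where $s_1=n$ and $s_k=2s_{k-1}+2$ for $k\geq 2$. In particular, if $I$ is a right nilpotent ideal of $A$ and $A/I$ is an r-nil algebra, then $A$ is an r-nil algebra.
   Context: A Novikov algebra is a (not necessarily associative or unital) algebra satisfying the identities $(x,y,z)=(y,x,z)$ and $(xy)z=(xz)y$, where $(x,y,z)=(xy)z-x(yz)$. Left-normed powers of an element: $x^1=x$, $x^n=x^{n-1}x$ for $n>1$. An element $x$ is r-nilpotent if $x^n=0$ for some $n>0$; an algebra is r-nil if all its elements are r-nilpotent. Ideals are two-sided. For an algebra $I$ put $I^{[1]}=I$ and $I^{[k]}=I^{[k-1]}I$ for $k>1$ (a product of subspaces is the linear span of products of their elements). $I$ is right nilpotent if $I^{[k]}=0$ for some positive integer $k$. *)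

(* Defs.v *)
From HB Require Import structures.
From mathcomp Require Import all_boot all_algebra.
From mathcomp Require Import boolp.

Set Implicit Arguments.
Unset Strict Implicit.
Unset Printing Implicit Defensive.

Import GRing.Theory.
Local Open Scope ring_scope.

(* MathComp's algebras ([lalgType], [algType]) are associative and unital, so
   the nonassociative, nonunital bilinear product is set up here. *)

Declare Scope naalg_scope.
Delimit Scope naalg_scope with NA.

HB.mixin Record Lmodule_isNAAlgebra (F : fieldType) A of GRing.Lmodule F A := {
  namul : A -> A -> A;
  namulDl : forall x y z : A, namul (x + y) z = namul x z + namul y z;
  namulDr : forall x y z : A, namul x (y + z) = namul x y + namul x z;
  namulZl : forall (a : F) (x y : A), namul (a *: x) y = a *: namul x y;
  namulZr : forall (a : F) (x y : A), namul x (a *: y) = a *: namul x y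
}.

#[short(type="naAlgType")]
HB.structure Definition NAAlgebra (F : fieldType) :=
  { A of Lmodule_isNAAlgebra F A & GRing.Lmodule F A }.

Notation "x *~* y" := (namul x y)
  (at level 40, left associativity) : naalg_scope.
Local Open Scope naalg_scope.

Definition associator (F : fieldType) (A : naAlgType F) (x y z : A) : A :=
  (x *~* y) *~* z - x *~* (y *~* z).

HB.mixin Record NAAlgebra_isNovikov (F : fieldType) A of NAAlgebra F A := {
  novikov_lsym : forall x y z : A, associator x y z = associator y x z;
  novikov_rcomm : forall x y z : A, (x *~* y) *~* z = (x *~* z) *~* y
}.

#[short(type="novikovAlgType")]
HB.structure Definition NovikovAlgebra (F : fieldType) :=
  { A of NAAlgebra_isNovikov F A & NAAlgebra F A }.

(* [lpow x n] is x^n for n > 0; [lpow x 0 = x] is a junk value. *)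
Definition lpow (F : fieldType) (A : naAlgType F) (x : A) (n : nat) : A :=
  iter n.-1 (fun y => y *~* x) x.

Definition r_nilpotent (F : fieldType) (A : naAlgType F) (x : A) : Prop :=
  exists2 n : nat, (0 < n)%N & lpow x n = 0.

Definition r_nil (F : fieldType) (A : naAlgType F) : Prop :=
  forall x : A, r_nilpotent x.

HB.mixin Record isMulAbsorbing (F : fieldType) (A : naAlgType F)
    (I : {pred A}) := {
  idealMl : forall a x : A, x \in I -> a *~* x \in I;
  idealMr : forall a x : A, x \in I -> x *~* a \in I
}.

#[short(type="idealClosed")]
HB.structure Definition IdealClosed (F : fieldType) (A : naAlgType F) :=
  { I of isMulAbsorbing F A I & GRing.AddClosed A I
       & GRing.isScaleClosed F A I }.

Definition lspan (F : fieldType) (V : lmodType F) (S : V -> Prop) : {pred V} :=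
  fun x => `[< exists2 s : seq (F * V), (forall p, p \in s -> S p.2)
                 & x = \sum_(p <- s) p.1 *: p.2 >].

Definition prod_span (F : fieldType) (A : naAlgType F) (U V : {pred A}) :
    {pred A} :=
  lspan (fun z => exists u v, [/\ u \in U, v \in V & z = u *~* v]).

(* [ideal_pow I k] is I^[k] for k > 0; [ideal_pow I 0 = I] is a junk value. *)
Definition ideal_pow (F : fieldType) (A : naAlgType F) (I : {pred A})
    (k : nat) : {pred A} :=
  iter k.-1 (fun U => prod_span U I) I.

Definition right_nilpotent (F : fieldType) (A : naAlgType F) (I : {pred A}) :
    Prop :=
  exists2 k : nat, (0 < k)%N & ideal_pow I k =i pred1 0.

(* The quotient algebra A / I, on top of MathComp's additive quotient, which
   asks for a predicate closed under opposite; an ideal is, by scaling by -1. *)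
Definition ideal_pred (F : fieldType) (A : naAlgType F) (I : idealClosed A) :
    {pred A} := I.

Lemma ideal_zmod_closed (F : fieldType) (A : naAlgType F) (I : idealClosed A) :
  zmod_closed (ideal_pred I).
Proof.
split=> [|x y xI yI]; first exact: (@rpred0 A I).
by rewrite -scaleN1r; apply: (@rpredD A I) => //; apply: rpredZ.
Qed.

HB.instance Definition _ (F : fieldType) (A : naAlgType F) (I : idealClosed A) :=
  GRing.isZmodClosed.Build A (ideal_pred I) (ideal_zmod_closed I).

Definition quot_alg (F : fieldType) (A : naAlgType F) (I : idealClosed A) :
    Type :=
  Quotient.quot (ideal_pred I).

Section QuotAlg.
Local Open Scope quotient_scope.
Variables (F : fieldType) (A : naAlgType F) (I : idealClosed A).
Local Notation Q := (quot_alg I).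

HB.instance Definition _ := GRing.Zmodule.on Q.
HB.instance Definition _ : EqQuotient A (Quotient.equiv (ideal_pred I)) Q :=
  EqQuotient.on Q.

Definition quot_scale (a : F) : Q -> Q := lift_op1 Q ( *:%R a).
Definition quot_mul : Q -> Q -> Q := lift_op2 Q (@namul F A).

Lemma pi_quotD (x y : A) : \pi_Q (x + y) = \pi_Q x + \pi_Q y.
Proof. exact: Quotient.pi_add. Qed.

Lemma pi_quotN (x : A) : \pi_Q (- x) = - \pi_Q x.
Proof. exact: Quotient.pi_opp. Qed.

Lemma eq_pi_quot (x y : A) : (\pi_Q x = \pi_Q y) <-> (x - y \in I).
Proof.
split=> [/eqP|h]; first by rewrite -Quotient.idealrBE.
by apply/eqP; rewrite -Quotient.idealrBE.
Qed.

Lemma pi_quotZ (a : F) (x : A) : quot_scale a (\pi_Q x) = \pi_Q (a *: x).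
Proof.
rewrite /quot_scale; unlock; apply/eq_pi_quot.
rewrite -scalerBr; apply: rpredZ; apply/eq_pi_quot.
by rewrite reprK.
Qed.

Lemma pi_quotM (x y : A) : quot_mul (\pi_Q x) (\pi_Q y) = \pi_Q (x *~* y).
Proof.
rewrite /quot_mul; unlock; apply/eq_pi_quot.
set x' := repr _; set y' := repr _.
have hx : x' - x \in I by apply/eq_pi_quot; rewrite reprK.
have hy : y' - y \in I by apply/eq_pi_quot; rewrite reprK.
have -> : x' *~* y' - x *~* y = (x' - x) *~* y' + x *~* (y' - y).
  have negl u v : (- u) *~* v = - (u *~* v) :> A.
    by rewrite -scaleN1r namulZl scaleN1r.
  have negr u v : u *~* (- v) = - (u *~* v) :> A.
    by rewrite -scaleN1r namulZr scaleN1r.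
  by rewrite namulDl namulDr negl negr addrA subrK.
by apply: rpredD; [apply: idealMr | apply: idealMl].
Qed.

Lemma quot_scalerA a b v : quot_scale a (quot_scale b v) = quot_scale (a * b) v.
Proof. by elim/quotW: v => v; rewrite !pi_quotZ scalerA. Qed.
Lemma quot_scale1r : left_id 1 quot_scale.
Proof. by elim/quotW=> v; rewrite pi_quotZ scale1r. Qed.
Lemma quot_scalerDr : right_distributive quot_scale +%R.
Proof.
move=> a; elim/quotW=> u; elim/quotW=> v.
by rewrite -pi_quotD !pi_quotZ scalerDr pi_quotD.
Qed.
Lemma quot_scalerDl v : {morph quot_scale^~ v : a b / a + b}.
Proof.
by elim/quotW: v => v a b /=; rewrite !pi_quotZ scalerDl pi_quotD.
Qed.

HB.instance Definition _ := GRing.Zmodule_isLmodule.Build F Q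
  quot_scalerA quot_scale1r quot_scalerDr quot_scalerDl.

Lemma pi_quot_scale (a : F) (x : A) : a *: \pi_Q x = \pi_Q (a *: x).
Proof. exact: pi_quotZ. Qed.

Lemma quot_mulDl x y z : quot_mul (x + y) z = quot_mul x z + quot_mul y z.
Proof.
elim/quotW: x => x; elim/quotW: y => y; elim/quotW: z => z.
by rewrite -pi_quotD !pi_quotM namulDl pi_quotD.
Qed.
Lemma quot_mulDr x y z : quot_mul x (y + z) = quot_mul x y + quot_mul x z.
Proof.
elim/quotW: x => x; elim/quotW: y => y; elim/quotW: z => z.
by rewrite -pi_quotD !pi_quotM namulDr pi_quotD.
Qed.
Lemma quot_mulZl a x y : quot_mul (a *: x) y = a *: quot_mul x y.
Proof.
elim/quotW: x => x; elim/quotW: y => y.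
by rewrite pi_quot_scale !pi_quotM namulZl pi_quot_scale.
Qed.
Lemma quot_mulZr a x y : quot_mul x (a *: y) = a *: quot_mul x y.
Proof.
elim/quotW: x => x; elim/quotW: y => y.
by rewrite pi_quot_scale !pi_quotM namulZr pi_quot_scale.
Qed.

HB.instance Definition _ := Lmodule_isNAAlgebra.Build F Q
  quot_mulDl quot_mulDr quot_mulZl quot_mulZr.

Lemma pi_quot_mul (x y : A) : (\pi_Q x : Q) *~* \pi_Q y = \pi_Q (x *~* y).
Proof. exact: pi_quotM. Qed.

Lemma pi_quot_lpow (x : A) (n : nat) : lpow (\pi_Q x : Q) n = \pi_Q (lpow x n).
Proof.
by rewrite /lpow; elim: n.-1 => //= m ->; rewrite pi_quot_mul.
Qed.

Lemma pi_quot_eq0 (x : A) : (\pi_Q x = 0 :> Q) <-> (x \in I).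
Proof.
have -> : (0 : Q) = \pi_Q 0 by rewrite -[x in \pi_Q x](subrr 0) pi_quotD pi_quotN subrr.
by rewrite -[x in x \in I]subr0; exact: eq_pi_quot.
Qed.

End QuotAlg.

Section QuotNovikov.
Local Open Scope quotient_scope.
Variables (F : fieldType) (A : novikovAlgType F) (I : idealClosed A).
Local Notation Q := (quot_alg I).

Lemma quot_lsym (x y z : Q) : associator x y z = associator y x z.
Proof.
elim/quotW: x => x; elim/quotW: y => y; elim/quotW: z => z.
rewrite /associator !pi_quot_mul -!pi_quotN -!pi_quotD.
by congr (\pi_Q _); exact: novikov_lsym.
Qed.

Lemma quot_rcomm (x y z : Q) : (x *~* y) *~* z = (x *~* z) *~* y.
Proof.
elim/quotW: x => x; elim/quotW: y => y; elim/quotW: z => z.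
by rewrite !pi_quot_mul novikov_rcomm.
Qed.

HB.instance Definition _ := NAAlgebra_isNovikov.Build F Q quot_lsym quot_rcomm.

End QuotNovikov.

(* [sseq n k] is s_k with s_1 = n; [sseq n 0 = n] is a junk value. *)
Definition sseq (n k : nat) : nat := iter k.-1 (fun s => 2 * s + 2)%N n.

(* Main.v *)
Require Import Defs.
From HB Require Import structures.
From mathcomp Require Import all_boot all_algebra.
From mathcomp Require Import boolp.

(** With R the right multiplication by x, the Novikov identities give
    x^i x^j = x^(i+j) + (j-1) (x x^2 - x^3) R^(i+j-3).  The right-hand side is
    affine in j for fixed N = i + j, so x^N is an integer combination of any two
    products with consecutive j.  For N = 2s + 2 and j = s, s + 1 both products
    lie in I^[k] I as soon as x^s lies in I^[k] and in I, because I^[k] is a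
    right ideal. *)

Set Implicit Arguments.
Unset Strict Implicit.
Unset Printing Implicit Defensive.

Import GRing.Theory.
Local Open Scope ring_scope.
Local Open Scope naalg_scope.

Lemma sseqS n k : (0 < k)%N -> sseq n k.+1 = (2 * sseq n k + 2)%N.
Proof. by case: k. Qed.

(** Keeps every [s_k] positive and ensures that x^n in [I] forces x^(s_k) in [I]. *)
Lemma leq_sseq n k : (n <= sseq n k)%N.
Proof.
case: k => [|k]; first exact: leqnn.
elim: k => [|k IHk]; first exact: leqnn.
by rewrite sseqS // mul2n -addnn -addnA; apply: leq_trans IHk (leq_addr _ _).
Qed.

Section Lspan.
Variables (F : fieldType) (V : lmodType F) (S : V -> Prop).

Lemma lspan0 : 0 \in lspan S.
Proof. by apply/asboolP; exists [::] => //; rewrite big_nil. Qed.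

Lemma lspan_sub u : S u -> u \in lspan S.
Proof.
move=> Su; apply/asboolP; exists [:: (1, u)] => [p|].
  by rewrite inE => /eqP ->.
by rewrite big_seq1 scale1r.
Qed.

Lemma lspanD u v :
  u \in lspan S -> v \in lspan S -> u + v \in lspan S.
Proof.
move=> /asboolP[s Ss ->] /asboolP[t St ->]; apply/asboolP.
exists (s ++ t) => [p|]; last by rewrite big_cat.
by rewrite mem_cat => /orP[/Ss|/St].
Qed.

Lemma lspanZ a u :
  u \in lspan S -> a *: u \in lspan S.
Proof.
move=> /asboolP[s Ss ->]; apply/asboolP.
exists [seq (a * p.1, p.2) | p <- s] => [p /mapP[q /Ss Sq ->] //|].
by rewrite big_map scaler_sumr; apply: eq_bigr => p _; rewrite scalerA.
Qed.

Lemma lspan_ind (P : V -> Prop) :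
    P 0 -> (forall a u v, S u -> P v -> P (a *: u + v)) ->
  forall u, u \in lspan S -> P u.
Proof.
move=> P0 PD u /asboolP[s Ss ->].
elim: s Ss => [|p s IHs] Ss; first by rewrite big_nil.
rewrite big_cons; apply: PD; first by apply: Ss; rewrite mem_head.
by apply: IHs => q qs; apply: Ss; rewrite inE qs orbT.
Qed.

End Lspan.

Section NAAlgebraLemmas.
Variables (F : fieldType) (A : naAlgType F).
Implicit Types (x y z : A) (U V : {pred A}).

Lemma namul0l y : (0 : A) *~* y = 0.
Proof. by apply: (addrI (0 *~* y)); rewrite -namulDl !addr0. Qed.

Lemma namulMnl x y n : (x *+ n) *~* y = (x *~* y) *+ n.
Proof.
by elim: n => [|n IHn]; rewrite ?mulr0n ?namul0l // !mulrS namulDl IHn.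
Qed.

Lemma lpowS x n : (0 < n)%N -> lpow x n.+1 = lpow x n *~* x.
Proof. by case: n. Qed.

Lemma mem_prod_span U V x y : x \in U -> y \in V -> x *~* y \in prod_span U V.
Proof. by move=> Ux Vy; apply: lspan_sub; exists x, y. Qed.

Lemma ideal_powS (I : {pred A}) k :
  (0 < k)%N -> ideal_pow I k.+1 = prod_span (ideal_pow I k) I.
Proof. by case: k. Qed.

End NAAlgebraLemmas.

Section NovikovLemmas.
Variables (F : fieldType) (A : novikovAlgType F).
Implicit Types (x y : A) (U : {pred A}).

Definition right_closed U := forall x y, x \in U -> x *~* y \in U.

(** Since (uw)y = (uy)w, multiplying a generator by y on the right only affects its left factor. *)
Lemma right_closed_prod_span U (V : {pred A}) :
  right_closed U -> right_closed (prod_span U V).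
Proof.
move=> Ur x y; move: x; apply: lspan_ind => [|a _ v [u [w [uU wV ->]]] IHv].
  by rewrite namul0l; apply: lspan0.
rewrite namulDl namulZl novikov_rcomm.
by apply: lspanD => //; apply/lspanZ/mem_prod_span => //; apply: Ur.
Qed.

Lemma right_closed_ideal_pow (I : idealClosed A) k :
  right_closed (ideal_pow I k).
Proof.
rewrite /ideal_pow; elim: k.-1 => [|m IHm] /=.
  by move=> x y; apply: Defs.idealMr.
exact: right_closed_prod_span.
Qed.

Lemma lpow_right_closed U x m n :
  right_closed U -> (0 < m)%N -> (m <= n)%N -> lpow x m \in U -> lpow x n \in U.
Proof.
move=> Ur m_gt0 /subnKC <- xmU; elim: (n - m)%N => [|d IHd]; first by rewrite addn0.
by rewrite addnS lpowS ?addn_gt0 ?m_gt0 //; apply: Ur.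
Qed.

Local Notation R x n := (iter n (fun y => y *~* x)).

Lemma iter_namulD x n y z : R x n (y + z) = R x n y + R x n z.
Proof. by elim: n => //= n ->; rewrite namulDl. Qed.

Lemma iter_namulMn x n y m : R x n (y *+ m) = R x n y *+ m.
Proof. by elim: n => //= n ->; rewrite namulMnl. Qed.

(** Right commutativity says that all right multiplications commute. *)
Lemma iter_namulC x n y z : R x n y *~* z = R x n (y *~* z).
Proof. by elim: n => //= n IHn; rewrite novikov_rcomm IHn. Qed.

Lemma iter_lpow x n m : R x n (lpow x m.+1) = lpow x (n + m).+1.
Proof. by rewrite /lpow /= iterD. Qed.

(** This is minus the associator (x, x, x). *)
Definition assoc_defect x := x *~* lpow x 2 - lpow x 3.

(** Induction on [m]: left symmetry for x, x^(m+1), x expresses x x^(m+2) as (x x^(m+1))x - x^(m+3)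
    + x^(m+1) x^2, and the last product contributes one more copy of the defect. *)
Lemma namul_lpow x m :
  x *~* lpow x m.+1 = lpow x m.+2 + R x m.-1 (assoc_defect x) *+ m.
Proof.
elim: m => [|m IHm]; first by rewrite addr0.
have lsym := novikov_lsym x (lpow x m.+1) x.
have x2E : lpow x m.+1 *~* (x *~* x) = lpow x m.+3 + R x m (assoc_defect x).
  rewrite {1}/lpow /= iter_namulC -[x *~* x]/(lpow x 2).
  rewrite -[x *~* lpow x 2](subrK (lpow x 3)) iter_namulD iter_lpow addn2.
  by rewrite addrC.
(* At m = 0 the predecessor is truncated, but the coefficient 0 kills both sides. *)
have RE : (R x m.-1 (assoc_defect x) *+ m) *~* x = R x m (assoc_defect x) *+ m.
  by case: m {IHm lsym x2E} => [|m]; rewrite ?mulr0n ?namul0l // namulMnl.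
move: lsym; rewrite /associator IHm namulDl RE x2E -!lpowS //.
rewrite opprD addNKr => /(canRL (subrK _)) lsym.
by rewrite mulrS addrCA lsym addNKr.
Qed.

(** As x^(i+1) is x under i right multiplications by x, and these can be moved outside the product,
    the case i = 0 suffices. *)
Lemma lpow_mul x i m :
  lpow x i.+1 *~* lpow x m.+1 =
  lpow x (i + m).+2 + R x (i + m.-1) (assoc_defect x) *+ m.
Proof.
by rewrite {1}/lpow /= iter_namulC namul_lpow iter_namulD iter_namulMn
  iter_lpow addnS iterD.
Qed.

(** The weights m+1 and -m add up to 1, while the defect terms cancel: (m+1)m - m(m+1) = 0. *)
Lemma lpow_comb x m :
  lpow x (2 * m.+1 + 2) =
  (lpow x m.+3 *~* lpow x m.+1) *+ m.+1 - (lpow x m.+2 *~* lpow x m.+2) *+ m.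
Proof.
rewrite !lpow_mul.
(* At m = 0 truncation makes the two iteration counts differ, but both defect terms have coefficient
   0. *)
case: m => [|m]; first by rewrite !addr0 mulr1n subr0.
have -> : (2 * m.+2 + 2 = (m.+3 + m.+1).+2)%N.
  by rewrite mul2n -addnn !addnS !addSn addn0.
rewrite !succnK !addSn !addnS 2!mulrnDl -!mulrnA mulnC.
by rewrite opprD addrACA subrr addr0 mulrS addrK.
Qed.

Lemma lpow_ideal_pow (I : idealClosed A) x n k :
    (0 < n)%N -> lpow x n \in I -> (0 < k)%N ->
  lpow x (sseq n k) \in ideal_pow I k.
Proof.
move=> n_gt0 xnI; case: k => // k _; elim: k => [|k IHk]; first exact: xnI.
rewrite sseqS // ideal_powS //.
have := leq_trans n_gt0 (leq_sseq n k.+1).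
(* Positivity lets [s_k] be written as a successor, the form used in [lpow_comb]. *)
case s_eq: (sseq n k.+1) IHk => [//|s] xsIk _.
have xmI m : (s < m)%N -> lpow x m \in I.
  move=> s_lt_m; apply: (@lpow_right_closed I x n) xnI => //.
    by move=> y z; apply: Defs.idealMr.
  by apply: leq_trans s_lt_m; rewrite -s_eq leq_sseq.
have xmIk m : (s < m)%N -> lpow x m \in ideal_pow I k.+1.
  move=> s_lt_m; apply: lpow_right_closed s_lt_m xsIk => //.
  exact: right_closed_ideal_pow.
(* Integer multiples become scalar multiples, so that closure of the span under sums and scaling
   applies. *)
rewrite lpow_comb -!scaler_nat -scaleNr.
apply: lspanD; apply/lspanZ/mem_prod_span; do 1?[apply: xmI | apply: xmIk];
  by rewrite // !ltnS ?leqW.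
Qed.

End NovikovLemmas.

Theorem theorem2p4 (F : fieldType) (A : novikovAlgType F) (I : idealClosed A) :
  (forall (x : A) (n : nat), (0 < n)%N -> lpow x n \in I ->
     forall k : nat, (1 <= k)%N -> lpow x (sseq n k) \in ideal_pow I k) /\
  (right_nilpotent I -> r_nil (quot_alg I) -> r_nil A).
Proof.
split=> [x n n_gt0 xnI k|[k k_gt0 Ik0] nilQ x]; first exact: lpow_ideal_pow.
have [n n_gt0] := nilQ (\pi_(quot_alg I)%qT x).
rewrite pi_quot_lpow => /pi_quot_eq0 xnI.
(* With x^n in [I] and I^[k] = 0, the exponent [s_k] kills x. *)
exists (sseq n k); first exact: leq_trans n_gt0 (leq_sseq n k).
by apply/eqP; rewrite -[_ == _]/(_ \in pred1 0) -Ik0 lpow_ideal_pow.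
Qed.
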